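(* Let $E,J,R\in\mathbb{C}^{n,n}$ and $B\in\mathbb{C}^{n,m}$ with $E=E^H\ge 0$, $R=R^H\ge 0$, $J=-J^H$ and $B$ of full column rank (the coefficients of a port-Hamiltonian descriptor system $E\dot x=(J-R)x+Bu$, $y=B^Hx$). There exist matrices $K,F_S,F_H\in\mathbb{C}^{m,m}$ with $F_S=-F_S^H$ and $F_H=F_H^H$ such that the pair $(E+BKB^H,\;J+BF_SB^H-(R+BF_HB^H))$ is regular and $E+BKB^H\ge 0$, $R+BF_HB^H\ge 0$, if and only if $$\operatorname{rank}\begin{bmatrix}E & J-R & B\end{bmatrix}=n.$$ Moreover, if this rank condition holds, then for any integer $r$ satisfying $$\operatorname{rank}\begin{bmatrix}E & B\end{bmatrix}-\operatorname{rank}(B)\le r\le\operatorname{rank}\begin{bmatrix}E & B\end{bmatrix}$$ there exist matrices $K$, $F_H=F_H^H$ in $\mathbb{C}^{m,m}$ and $F_S=0$ such that $(E+BKB^H,\;J+BF_SB^H-(R+BF_HB^H))$ is regular and $$\operatorname{rank}(E+BKB^H)=r,\qquad E+BKB^H\ge 0,\qquad R+BF_HB^H\ge 0.$$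
   Context: $\mathbb{C}^{p,q}$ denotes the complex $p\times q$ matrices. $M\ge 0$ ($M>0$) means that $M$ is Hermitian positive semidefinite (positive definite). A pair $(E,A)$ of square matrices (identified with the pencil $\lambda E-A$) is regular if $\det(\lambda_0E-A)\ne 0$ for some $\lambda_0\in\mathbb{C}$. *)

(* Defs.v *)
From mathcomp Require Import all_boot all_order all_algebra.

Set Implicit Arguments.
Unset Strict Implicit.
Unset Printing Implicit Defensive.

Import Order.TTheory GRing.Theory Num.Theory Num.Def.
Local Open Scope ring_scope.
Local Open Scope sesquilinear_scope.

(* M >= 0: Hermitian and positive semidefinite. In a numClosedFieldType,
   0 <= z also says that z is real. *)
Definition psdmx (C : numClosedFieldType) (n : nat) (M : 'M[C]_n) : Prop :=
  M = M ^t* /\ forall x : 'cV[C]_n, 0 <= (x ^t* *m M *m x) 0 0.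

Definition regular_pair (C : fieldType) (n : nat) (E A : 'M[C]_n) : Prop :=
  exists lambda0 : C, \det (lambda0 *: E - A) != 0.

(* Main.v *)
(** If $x$ is a left null vector of $\lambda E' - (J - R')$ with $E', R' \geq 0$,
    $J$ skew-Hermitian and $\lambda = 1$, then the Hermitian part of the pencil
    gives $x(E' + R')x^H = 0$, hence $xE' = xR' = 0$ and then $xJ = 0$. With $R' = R + BB^H$
    this also gives $xR = 0$ and $xB = 0$, so $xE = 0$, which the rank condition
    forbids. Thus $F_H = I$ makes the pencil regular for every $K$ such that
    $E + BKB^H \geq 0$. For the rank, $E + BB^H$ has the maximal rank
    $\mathrm{rank}[E\ B]$; and as long as the rank of $E' = E + BKB^H$ exceeds
    $\mathrm{rank}[E\ B] - \mathrm{rank}\,B$, the ranges of $E'$ and $B$ share a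
    nonzero vector $E'w = Bu$, and subtracting $E'ww^HE' / (w^HE'w) = Buu^HB^H / (w^HE'w)$
    keeps $E'$ semidefinite and lowers its rank by one. *)

Require Import Defs.
From mathcomp Require Import all_boot all_order all_algebra.
From mathcomp Require Import reals complex.
From mathcomp Require Import zify ring.

Set Implicit Arguments.
Unset Strict Implicit.
Unset Printing Implicit Defensive.

Import Order.TTheory GRing.Theory Num.Theory Num.Def.
Local Open Scope ring_scope.
Local Open Scope sesquilinear_scope.

(** * Algebra of the conjugate transpose and of the squared norm of a row *)

Section ConjugateTranspose.
Context {C : numClosedFieldType}.

Lemma trmxC_mul p q s (A : 'M[C]_(p, q)) (B : 'M[C]_(q, s)) :
  (A *m B) ^t* = B ^t* *m A ^t*.
Proof. by rewrite trmx_mul map_mxM. Qed.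

Lemma trmxCD p q (A B : 'M[C]_(p, q)) : (A + B) ^t* = A ^t* + B ^t*.
Proof. by rewrite raddfD map_mxD. Qed.

Lemma trmxCB p q (A B : 'M[C]_(p, q)) : (A - B) ^t* = A ^t* - B ^t*.
Proof. by rewrite raddfB map_mxB. Qed.

Lemma trmxCZ p q (a : C) (A : 'M[C]_(p, q)) : (a *: A) ^t* = a^* *: A ^t*.
Proof. by rewrite linearZ /= map_mxZ. Qed.

Lemma trmxC0 p q : (0 : 'M[C]_(p, q)) ^t* = 0.
Proof. by rewrite trmx0 map_mx0. Qed.

Lemma trmxC1 p : (1%:M : 'M[C]_p) ^t* = 1%:M.
Proof. by rewrite trmx1 map_mx1. Qed.

Lemma trmxC_scalar (A : 'M[C]_1) : A ^t* 0 0 = (A 0 0)^*.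
Proof. by rewrite !mxE. Qed.

Lemma gram_row_ge0 n (y : 'rV[C]_n) : 0 <= (y *m y ^t*) 0 0.
Proof. by rewrite mxE sumr_ge0 // => j _; rewrite !mxE mul_conjC_ge0. Qed.

Lemma gram_row_eq0 n (y : 'rV[C]_n) : (y *m y ^t*) 0 0 = 0 -> y = 0.
Proof.
rewrite mxE => /psumr_eq0P y0; apply/rowP => j; rewrite [RHS]mxE.
have /y0/(_ j isT)/eqP : forall j, true -> 0 <= y 0 j * y ^t* j 0.
  by move=> k _; rewrite !mxE mul_conjC_ge0.
by rewrite !mxE mul_conjC_eq0 => /eqP.
Qed.

End ConjugateTranspose.

(** * Semidefinite forms evaluated on row vectors, and their kernels *)

Section Semidefinite.
Context {C : numClosedFieldType}.

Lemma psdmx_row n (M : 'M[C]_n) (v : 'rV[C]_n) :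
  psdmx M -> 0 <= (v *m M *m v ^t*) 0 0.
Proof. by case=> _ /(_ (v ^t*)); rewrite trmxCK. Qed.

(** A null vector of the form minimises it. Moving from $v$ to $v - ty$ with $y = vM$ gives the
    value $-2tb + t^2d \ge 0$, where $b = yy^H$ and $d = yMy^H$; a small $t > 0$ forces $b = 0$. *)
Lemma psdmx_row_eq0 n (M : 'M[C]_n) (v : 'rV[C]_n) :
  psdmx M -> (v *m M *m v ^t*) 0 0 = 0 -> v *m M = 0.
Proof.
move=> psdM v0; have [hM _] := psdM; pose y := v *m M.
have y_adj : M *m v ^t* = y ^t* by rewrite trmxC_mul -hM.
apply: gram_row_eq0; rewrite -/y.
set b := (y *m y ^t*) 0 0; set d := (y *m M *m y ^t*) 0 0.
have b_ge0 : 0 <= b := gram_row_ge0 y.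
have d_ge0 : 0 <= d := psdmx_row y psdM.
have d1_gt0 : 0 < d + 1 by rewrite ltr_wpDl.
(* Close to the minimiser $b/d$; the added 1 covers the case $d = 0$. *)
pose t := b / (d + 1).
have t_ge0 : 0 <= t by rewrite divr_ge0 // ltW.
have := psdmx_row (v - t *: y) psdM.
rewrite trmxCB trmxCZ (CrealP (ger0_real t_ge0)) !mulmxBl !mulmxBr.
rewrite -!scalemxAl -!scalemxAr -[y *m M *m v ^t*]mulmxA y_adj -/y.
have -> : y *m v ^t* = 0 by apply/matrixP=> i j; rewrite !ord1 v0 mxE.
have yy : y *m y ^t* = b%:M by exact: mx11_scalar.
have yMy : y *m M *m y ^t* = d%:M by exact: mx11_scalar.
rewrite sub0r yy yMy !mxE eqxx !mulr1n.
have -> : - (t * b) - (t * b - t * (t * d)) = - (t * b * (1 + (d + 1)^-1)).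
  rewrite /t; field; exact: lt0r_neq0.
rewrite oppr_ge0 pmulr_lle0; last by rewrite ltr_pwDl ?invr_ge0 // ltW.
rewrite /t mulrAC pmulr_lle0 ?invr_gt0 // => bb_le0.
have : b * b == 0 by rewrite eq_le bb_le0 mulr_ge0.
by rewrite mulf_eq0 orbb => /eqP.
Qed.

Lemma psdmx_congr n p (M : 'M[C]_n) (P : 'M[C]_(n, p)) :
  psdmx M -> psdmx (P ^t* *m M *m P).
Proof.
move=> [hM psdM]; split=> [|x]; first by rewrite !trmxC_mul trmxCK -hM mulmxA.
by have := psdM (P *m x); rewrite trmxC_mul !mulmxA.
Qed.

Lemma psdmxD n (M N : 'M[C]_n) : psdmx M -> psdmx N -> psdmx (M + N).
Proof.
move=> [hM psdM] [hN psdN]; split=> [|x]; first by rewrite trmxCD -hM -hN.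
by rewrite mulmxDr mulmxDl mxE addr_ge0.
Qed.

Lemma psdmx1 n : psdmx (1%:M : 'M[C]_n).
Proof.
split=> [|x]; first by rewrite trmxC1.
by rewrite mulmx1 -{2}(trmxCK x) gram_row_ge0.
Qed.

Lemma psdmx_gram n p (B : 'M[C]_(n, p)) : psdmx (B *m B ^t*).
Proof. by have := psdmx_congr (B ^t*) (psdmx1 p); rewrite mulmx1 trmxCK. Qed.

Lemma psdmxD_ker n (M N : 'M[C]_n) (v : 'rV[C]_n) :
  psdmx M -> psdmx N -> (v *m (M + N) *m v ^t*) 0 0 = 0 ->
  v *m M = 0 /\ v *m N = 0.
Proof.
move=> psdM psdN; rewrite mulmxDr mulmxDl mxE => /eqP.
rewrite paddr_eq0 ?psdmx_row // => /andP[/eqP M0 /eqP N0].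
by split; apply: psdmx_row_eq0.
Qed.

Lemma gram_ker n p (B : 'M[C]_(n, p)) (v : 'rV[C]_n) :
  v *m (B *m B ^t*) = 0 -> v *m B = 0.
Proof.
move=> vB; apply: gram_row_eq0.
by rewrite trmxC_mul mulmxA -[X in X *m _]mulmxA vB mul0mx mxE.
Qed.

End Semidefinite.

(** * Tuning the rank of $E + BKB^H$ within the semidefinite matrices *)

Section RankShift.
Context {C : numClosedFieldType}.

(** The change is right multiplication by a unitriangular block matrix. One inequality suffices,
    since $-X$ undoes $X$. *)
Lemma rank_row_mx_addMr (F : fieldType) n m (E : 'M[F]_n) (B : 'M[F]_(n, m)) X :
  \rank (row_mx (E + B *m X) B) = \rank (row_mx E B).
Proof.
have le (E0 : 'M_n) X0 :
    (\rank (row_mx (E0 + B *m X0) B) <= \rank (row_mx E0 B))%N.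
  have -> : row_mx (E0 + B *m X0) B = row_mx E0 B *m block_mx 1%:M 0 X0 1%:M.
    by rewrite mul_row_block !mulmx1 mulmx0 add0r.
  exact: mxrankM_maxl.
apply/eqP; rewrite eqn_leq le /=.
by have := le (E + B *m X) (- X); rewrite mulmxN addrK.
Qed.

(** Dimension formula for the sum and intersection of the two column spaces, read on transposes
    because [mxalgebra] works with row spaces. *)
Lemma col_space_cap_neq0 (F : fieldType) n m (E : 'M[F]_n) (B : 'M[F]_(n, m)) :
  (\rank (row_mx E B) < \rank E + \rank B)%N ->
  exists w u, E *m w = B *m u /\ E *m w != 0 :> 'cV_n.
Proof.
rewrite -mxrank_tr tr_row_mx -addsmxE -(mxrank_tr E) -(mxrank_tr B).
rewrite -mxrank_sum_cap -[X in (X < _)%N]addn0 ltn_add2l lt0n mxrank_eq0.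
case/rowV0Pn => v; rewrite sub_capmx => /andP[/submxP[a va] /submxP[b vb]] v0.
have Ea : E *m a^T = v^T by rewrite va trmx_mul trmxK.
exists a^T, b^T; split; last by rewrite Ea trmx_eq0.
by rewrite Ea vb trmx_mul trmxK.
Qed.

(** One bound comes from a factorisation through $[E\ B]$, the other from an inclusion of left
    kernels. *)
Lemma rank_psdmx_addgram n m (E : 'M[C]_n) (B : 'M[C]_(n, m)) :
  psdmx E -> \rank (E + B *m B ^t*)%R = \rank (row_mx E B).
Proof.
move=> psdE; apply/eqP; rewrite eqn_leq; apply/andP; split.
  have -> : E + B *m B ^t* = row_mx E B *m col_mx 1%:M (B ^t*).
    by rewrite mul_row_col mulmx1.
  exact: mxrankM_maxl.
suff : (kermx (E + B *m B ^t*) <= kermx (row_mx E B))%MS.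
  move/mxrankS; rewrite !mxrank_ker.
  have := rank_leq_row (row_mx E B); have := rank_leq_row (E + B *m B ^t*).
  by lia.
apply/row_subP => i; apply/sub_kermxP; set v := row i _.
have v0 : v *m (E + B *m B ^t*) = 0 by apply/sub_kermxP; exact: row_sub.
have [vE /gram_ker vB] : v *m E = 0 /\ v *m (B *m B ^t*) = 0.
  apply: psdmxD_ker => //; first exact: psdmx_gram.
  by rewrite v0 mul0mx mxE.
by rewrite mul_mx_row vE vB row_mx0.
Qed.

(** [E1] is the compression of $E$ by the projection along $w$ that is orthogonal for the form $E$,
    hence semidefinite. It kills $w$, which $E$ does not, and differs from $E$ by a rank-one
    matrix. *)
Lemma psdmx_deflate n (E : 'M[C]_n) (w : 'cV[C]_n) :
  psdmx E -> E *m w != 0 ->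
  let c := (w ^t* *m E *m w) 0 0 in
  let E1 := E - c^-1 *: (E *m w *m (E *m w) ^t*) in
  psdmx E1 /\ ((\rank E1).+1 = \rank E)%N.
Proof.
move=> psdE Ew0 c E1; have [hE E_ge0] := psdE.
have c_ge0 : 0 <= c := E_ge0 w.
have wEw : w ^t* *m E *m w = c%:M by rewrite -mx11_scalar.
have c_neq0 : c != 0.
  apply: contraNneq Ew0 => c0.
  have /(congr1 (fun A => A ^t*)) : w ^t* *m E = 0.
    by apply: psdmx_row_eq0 => //; rewrite trmxCK.
  by rewrite trmxC_mul trmxCK -hE trmxC0 => ->.
have Ewh : (E *m w) ^t* = w ^t* *m E by rewrite trmxC_mul -hE.
have E1w : E1 *m w = 0.
  rewrite mulmxBl -scalemxAl Ewh -[E *m w *m _ *m w]mulmxA wEw mul_mx_scalar.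
  by rewrite scalerA mulVf // scale1r subrr.
have hE1 : E1 ^t* = E1.
  rewrite trmxCB trmxCZ (trmxC_mul (E *m w)) trmxCK -hE.
  by rewrite conj_Creal // ger0_real // invr_ge0.
pose P : 'M_n := 1%:M - c^-1 *: (w *m (w ^t* *m E)).
have EP : E *m P = E1.
  by rewrite mulmxBr mulmx1 -scalemxAr /E1 Ewh !mulmxA.
have PE : P ^t* *m E = E1 by rewrite -hE1 -EP trmxC_mul -hE.
split.
  have -> : E1 = P ^t* *m E *m P.
    by rewrite PE mulmxBr mulmx1 -scalemxAr (mulmxA E1 w) E1w mul0mx scaler0 subr0.
  exact: psdmx_congr.
apply/eqP; rewrite eqn_leq; apply/andP; split; last first.
  have {1}-> : E = E1 + c^-1 *: (E *m w *m (E *m w) ^t*) by rewrite subrK.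
  apply: leq_trans (mxrank_add _ _) _; rewrite -[(\rank E1).+1]addn1 leq_add2l.
  apply: leq_trans (mxrank_scale _ _) _.
  apply: leq_trans (mxrankM_maxl _ _) _; exact: rank_leq_col.
have sE1 : (E1 <= E)%MS by rewrite -PE submxMl.
(* Equal ranks would give $E = X E_1$, hence $Ew = 0$. *)
rewrite (ltn_leqif (mxrank_leqif_sup sE1)).
apply: contra Ew0 => /submxP[X ->].
by rewrite -mulmxA E1w mulmx0.
Qed.

Lemma psdmx_rank_shift n m (E : 'M[C]_n) (B : 'M[C]_(n, m)) k :
  psdmx E -> (k <= \rank B)%N ->
  exists K : 'M[C]_m, psdmx (E + B *m K *m B ^t*) /\
    (\rank (E + B *m K *m B ^t*)%R + k = \rank (row_mx E B))%N.
Proof.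
move=> psdE; elim: k => [_|k IHk ltkB].
  exists 1%:M; rewrite mulmx1 addn0 rank_psdmx_addgram //; split=> //.
  exact: psdmxD psdE (psdmx_gram B).
have [K [psdE' rE']] := IHk (ltnW ltkB); set E' := E + _ in psdE' rE'.
have : (\rank (row_mx E' B) < \rank E' + \rank B)%N.
  (* By induction the rank of $E'$ is $\mathrm{rank}[E\ B] - k$, and $k < \mathrm{rank}\,B$. *)
  suff -> : \rank (row_mx E' B) = \rank (row_mx E B) by rewrite -rE' ltn_add2l.
  by rewrite /E' -mulmxA rank_row_mx_addMr.
case/col_space_cap_neq0=> w [u [wu Ew0]].
have [psdE1 rE1] := psdmx_deflate psdE' Ew0.
set c := (w ^t* *m E' *m w) 0 0 in psdE1 rE1.
exists (K - c^-1 *: (u *m u ^t*)).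
have -> : E + B *m (K - c^-1 *: (u *m u ^t*)) *m B ^t*
        = E' - c^-1 *: (E' *m w *m (E' *m w) ^t*).
  rewrite wu trmxC_mul mulmxBr mulmxBl addrA -scalemxAr -scalemxAl.
  by rewrite !mulmxA.
by split=> //; rewrite addnS -addSn rE1.
Qed.

End RankShift.

(** * Regularity of the closed-loop pencil and the rank condition *)

Section Regularity.
Context {C : numClosedFieldType}.

(** A left null vector of $[E\ A\ B]$ annihilates the modified pencil at every $\lambda$. *)
Lemma regular_rank (F : fieldType) n m (E A : 'M[F]_n) (B : 'M[F]_(n, m)) X Y :
  regular_pair (E + B *m X) (A + B *m Y) ->
  \rank (row_mx E (row_mx A B)) = n.
Proof.
case=> l reg; apply/eqP; rewrite -/(row_free _) -kermx_eq0.
apply/rowV0P => v /sub_kermxP; rewrite !mul_mx_row.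
rewrite -[in X in _ = X -> _]row_mx0 => /eq_row_mx[vE].
rewrite -[in X in _ = X -> _]row_mx0 => /eq_row_mx[vA vB].
apply/eqP; apply: contraNT reg => v0; apply/det0P; exists v => //.
rewrite mulmxBr -scalemxAr !mulmxDr vE vA !mulmxA vB !mul0mx.
by rewrite !addr0 scaler0 subr0.
Qed.

Lemma regular_dissipative n (E J D : 'M[C]_n) :
  psdmx E -> psdmx D -> J = - J ^t* ->
  (forall v : 'rV_n, v *m E = 0 -> v *m J = 0 -> v *m D = 0 -> v = 0) ->
  regular_pair E (J - D).
Proof.
move=> psdE psdD hJ ker0; exists 1; rewrite scale1r opprB addrA.
apply/negP => /det0P[v /eqP v_neq0 v0]; apply: v_neq0.
set z := (v *m J *m v ^t*) 0 0.
have vED : v *m (E + D) *m v ^t* = v *m J *m v ^t*.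
  by move/eqP: v0; rewrite mulmxBr subr_eq0 => /eqP ->.
have z_ge0 : 0 <= z.
  by rewrite /z -vED; exact: psdmx_row (psdmxD psdE psdD).
have z0 : z = 0.
  (* A skew-Hermitian form takes imaginary values, while $z \ge 0$ is real. *)
  have : z^* = - z.
    rewrite -trmxC_scalar !trmxC_mul trmxCK mulmxA.
    by rewrite -[J ^t*]opprK -hJ mulmxN mulNmx mxE.
  rewrite (CrealP (ger0_real z_ge0)) => /eqP.
  by rewrite -addr_eq0 -mulr2n mulrn_eq0 => /eqP.
have [vE vD] : v *m E = 0 /\ v *m D = 0.
  by apply: psdmxD_ker; rewrite // vED.
apply: ker0 => //.
by move/eqP: v0; rewrite mulmxBr mulmxDr vE vD addr0 sub0r oppr_eq0 => /eqP.
Qed.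

Lemma regular_feedback n m (E J D : 'M[C]_n) (B : 'M[C]_(n, m)) (K : 'M[C]_m) :
  psdmx (E + B *m K *m B ^t*) -> psdmx D -> J = - J ^t* ->
  \rank (row_mx E (row_mx (J - D) B)) = n ->
  regular_pair (E + B *m K *m B ^t*) (J - (D + B *m B ^t*)).
Proof.
move=> psdE psdD hJ rk; apply: regular_dissipative => //.
  exact: psdmxD psdD (psdmx_gram B).
move=> v vE vJ vDB.
have [vD /gram_ker vB] : v *m D = 0 /\ v *m (B *m B ^t*) = 0.
  apply: psdmxD_ker => //; first exact: psdmx_gram.
  by rewrite vDB mul0mx mxE.
move: vE; rewrite mulmxDr !mulmxA vB !mul0mx addr0 => vE.
have /eqP : v *m row_mx E (row_mx (J - D) B) = 0.
  by rewrite !mul_mx_row mulmxBr vE vJ vD vB subr0 !row_mx0.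
by rewrite mulmx_free_eq0 /row_free ?rk // => /eqP.
Qed.

End Regularity.

Theorem theorem11 (R : realType) (n m : nat)
    (E J D : 'M[R[i]]_n) (B : 'M[R[i]]_(n, m))
    (hE : psdmx E) (hD : psdmx D) (hJ : J = - J ^t*) (hB : \rank B = m) :
  ((exists K FS FH : 'M[R[i]]_m,
      [/\ FS = - FS ^t*, FH = FH ^t*,
          regular_pair (E + B *m K *m B ^t*)
            (J + B *m FS *m B ^t* - (D + B *m FH *m B ^t*)),
          psdmx (E + B *m K *m B ^t*)
        & psdmx (D + B *m FH *m B ^t*)])
   <-> \rank (row_mx E (row_mx (J - D)%R B)) = n)
  /\
  (\rank (row_mx E (row_mx (J - D)%R B)) = n ->
   forall r : int,
     (\rank (row_mx E B))%:Z - (\rank B)%:Z <= r ->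
     r <= (\rank (row_mx E B))%:Z ->
   exists K FS FH : 'M[R[i]]_m,
     FH = FH ^t* /\ FS = 0 /\
     regular_pair (E + B *m K *m B ^t*)
       (J + B *m FS *m B ^t* - (D + B *m FH *m B ^t*)) /\
     (\rank (E + B *m K *m B ^t*)%R)%:Z = r /\
     psdmx (E + B *m K *m B ^t*) /\
     psdmx (D + B *m FH *m B ^t*)).
Proof.
(* The choice $F_S = 0$, $F_H = I$ serves both claims; $k$ is the drop below the maximal rank. *)
have realize k : \rank (row_mx E (row_mx (J - D)%R B)) = n ->
    (k <= \rank B)%N ->
    exists K, [/\ regular_pair (E + B *m K *m B ^t*)
        (J + B *m 0 *m B ^t* - (D + B *m 1%:M *m B ^t*)),
      (\rank (E + B *m K *m B ^t*)%R + k = \rank (row_mx E B))%N,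
      psdmx (E + B *m K *m B ^t*) & psdmx (D + B *m 1%:M *m B ^t*)].
  move=> rk kB; have [K [psdK rK]] := psdmx_rank_shift hE kB.
  exists K; rewrite mulmx0 mul0mx addr0 mulmx1.
  by split=> //; [exact: regular_feedback | exact: psdmxD hD (psdmx_gram B)].
split; [split|] => [[K [FS [FH [_ _ reg _ _]]]]|rk|rk r ler rle].
- apply: (@regular_rank _ _ _ _ _ _ (K *m B ^t*) ((FS - FH) *m B ^t*)).
  by rewrite mulmxBl mulmxBr !mulmxA addrACA -opprD.
- have [K [reg _ psdK psdF]] := realize 0 rk (leq0n _).
  by exists K, 0, 1%:M; split; rewrite // ?trmxC0 ?oppr0 // trmxC1.
(* The two bounds on $r$ say exactly that the drop lies between 0 and $\mathrm{rank}\,B$; the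
   absolute value only turns it into a natural number. *)
- have [k kB rE] : exists2 k, (k <= \rank B)%N & r = (\rank (row_mx E B))%:Z - k%:Z.
    by exists `|(\rank (row_mx E B))%:Z - r|%N; lia.
  have [K [reg rK psdK psdF]] := realize k rk kB.
  exists K, 0, 1%:M; split; first by rewrite trmxC1.
  by split=> //; split=> //; split; [rewrite rE -rK; lia|].
Qed.
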